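(* Let $A$ be a non-zero positive bounded operator on a complex Hilbert space $\mathscr{H}$ and let $B,C\in\mathbb{B}(\mathscr{H})$. Then for all $\alpha\in[0,1]$, $$w_A^2(\sqrt{\alpha}\,B\pm\sqrt{1-\alpha}\,C)\le w_{A,e}^2(B,C)\quad\text{(for both choices of sign)}$$ and $$w_{A,e}^2(B,C)\le w_A^2(\sqrt{\alpha}\,B+\sqrt{1-\alpha}\,C)+w_A^2(\sqrt{1-\alpha}\,B-\sqrt{\alpha}\,C).$$
   Context: $\mathbb{B}(\mathscr{H})$ is the algebra of bounded linear operators on $\mathscr{H}$. For $x,y\in\mathscr{H}$, $\langle x,y\rangle_A=\langle Ax,y\rangle$ and $\|x\|_A=\langle Ax,x\rangle^{1/2}$. For $T,B,C\in\mathbb{B}(\mathscr{H})$, the $A$-numerical radius is $w_A(T)=\sup\{|\langle Tx,x\rangle_A|:\|x\|_A=1\}$ and the $A$-Euclidean operator radius of the pair is $w_{A,e}(B,C)=\sup\{(|\langle Bx,x\rangle_A|^2+|\langle Cx,x\rangle_A|^2)^{1/2}: \|x\|_A=1\}$. For general bounded operators these suprema need not be finite and are taken in $[0,\infty]$, with $\infty^2=\infty$. Superscript $2$ denotes the square of the value. *)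

(* Defs.v *)
From HB Require Import structures.
From mathcomp Require Import all_boot all_order all_algebra sesquilinear.
From mathcomp Require Import complex.
From mathcomp Require Import all_classical all_reals all_analysis.

Set Implicit Arguments.
Unset Strict Implicit.
Unset Printing Implicit Defensive.

Import Order.TTheory GRing.Theory Num.Theory.
Import numFieldNormedType.Exports.

Local Open Scope classical_set_scope.
Local Open Scope ring_scope.

(* A complex Hilbert space is a complete normed space H over R[i] with an inner
   product [dot] (linear in its first argument, conjugate-linear in its second)
   that induces the norm of H; both sides below live in R[i]. *)
Definition induces_norm (R : realType) (H : completeNormedModType R[i])
    (dot : {dot H for @Num.conj R[i]}) : Prop :=
  forall x : H, `|x| ^+ 2 = dot x x.

Definition bounded_operator (R : realType) (H : completeNormedModType R[i])
    (T : {linear H -> H}) : Prop :=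
  bounded_near T (nbhs (0 : H)).

(* The order of R[i] makes [0 <= z] mean that z is real and nonnegative. *)
Definition positive_operator (R : realType) (H : completeNormedModType R[i])
    (dot : {dot H for @Num.conj R[i]}) (T : {linear H -> H}) : Prop :=
  forall x : H, 0 <= dot (T x) x.

Section SemiInnerProduct.
Variables (R : realType) (H : completeNormedModType R[i]).
Variables (dot : {dot H for @Num.conj R[i]}) (A : {linear H -> H}).

Definition A_inner (x y : H) : R[i] := dot (A x) y.

(* [A_inner x x] is real when A is positive; [complex.Re] only moves it to R. *)
Definition A_norm (x : H) : R := Num.sqrt (complex.Re (A_inner x x)).

(* The library's modulus on R[i] is R[i]-valued, with zero imaginary part. *)
Definition modulus (z : R[i]) : R := complex.Re `|z|.

(* Both suprema are over nonempty sets of nonnegative numbers when A is positive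
   and nonzero, so they lie in [0, +oo] as elements of \bar R. *)
Definition A_numerical_radius (T : {linear H -> H}) : \bar R :=
  ereal_sup [set (modulus (A_inner (T x) x))%:E | x in [set x | A_norm x = 1]].

Definition A_euclidean_radius (B C : {linear H -> H}) : \bar R :=
  ereal_sup
    [set (Num.sqrt (modulus (A_inner (B x) x) ^+ 2
                    + modulus (A_inner (C x) x) ^+ 2))%:E
    | x in [set x | A_norm x = 1]].

End SemiInnerProduct.

(* Main.v *)
(** For a unit vector [x], the point [(<Bx,x>_A, <Cx,x>_A)] of C^2 is mapped by
    the real orthogonal matrix with rows [(a, b)] and [(b, -a)], where
    [a^2 + b^2 = 1], to the values at [x] of the forms of [aB + bC] and [bB - aC].
    The Euclidean norm is preserved, so each squared value is at most the squared
    norm, which is the sum of the two; it remains to take suprema. *)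
Require Import Defs.
From HB Require Import structures.
From mathcomp Require Import all_boot all_order all_algebra sesquilinear.
From mathcomp Require Import complex ring.
From mathcomp Require Import all_classical all_reals all_analysis.

Import Order.TTheory GRing.Theory Num.Theory.
Import numFieldNormedType.Exports.

Local Open Scope complex_scope.
Local Open Scope ring_scope.

Lemma ereal_sup_image_ge {R : realType} {T : Type} {X : set T} (f : T -> R) {x} :
  X x -> ((f x)%:E <= ereal_sup [set (f z)%:E | z in X])%E.
Proof. by move=> Xx; apply: ereal_sup_ubound; exists x. Qed.

(** Squaring is monotone on nonnegative extended reals, even when the supremum is [+oo]. *)
Lemma sqr_ereal_sup_image_ge {R : realType} {T : Type} {X : set T} (f : T -> R)
    {x} : X x -> 0 <= f x ->
  ((f x ^+ 2)%:E <= ereal_sup [set (f z)%:E | z in X] ^+ 2)%E.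
Proof.
move=> Xx f0; rewrite EFin_expe !expe2.
by apply: lee_pmul; rewrite ?lee_fin//; exact: ereal_sup_image_ge.
Qed.

(* Nonemptiness matters: the supremum over the empty set is -oo, whose square
   is +oo. *)
Lemma sqr_ereal_sup_image_le (R : realType) (T : Type) (X : set T) (f : T -> R)
    (y : \bar R) : (X !=set0)%classic -> (forall x, 0 <= f x) ->
  (forall x, X x -> ((f x ^+ 2)%:E <= y)%E) ->
  (ereal_sup [set (f z)%:E | z in X] ^+ 2 <= y)%E.
Proof.
move=> [x0 Xx0] f0; case: y => [r| |] fy; last 2 first.
- exact: leey.
- by have := fy _ Xx0.
have r0 : 0 <= r.
  by rewrite -lee_fin; apply: le_trans (fy _ Xx0); rewrite lee_fin exprn_ge0.
have S0 : (0 <= ereal_sup [set (f z)%:E | z in X])%E.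
  by apply: le_trans (ereal_sup_image_ge f Xx0); rewrite lee_fin.
(* The square root is taken pointwise, where values are real; squaring the resulting bound is
   legitimate by [S0]. *)
have Sr : (ereal_sup [set (f z)%:E | z in X] <= (Num.sqrt r)%:E)%E.
  apply: ge_ereal_sup => _ [x Xx <-].
  by rewrite lee_fin -(ger0_norm (f0 x)) -sqrtr_sqr ler_wsqrtr// -lee_fin fy.
by rewrite -(sqr_sqrtr r0) EFin_expe !expe2 lee_pmul.
Qed.

Lemma modulus_ge0 (R : realType) (z : R[i]) : 0 <= modulus z.
Proof. by case: z => u v; rewrite /modulus /= sqrtr_ge0. Qed.

Lemma sqr_modulus {R : realType} (z : R[i]) :
  modulus z ^+ 2 = complex.Re z ^+ 2 + complex.Im z ^+ 2.
Proof. by case: z => u v; rewrite /modulus /= sqr_sqrtr// addr_ge0// sqr_ge0. Qed.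

Lemma sqr_modulus_rotation {R : realType} {a b : R} (z w : R[i]) :
  a ^+ 2 + b ^+ 2 = 1 ->
  modulus (a%:C * z + b%:C * w) ^+ 2 + modulus (b%:C * z - a%:C * w) ^+ 2 =
  modulus z ^+ 2 + modulus w ^+ 2.
Proof.
(* Writing the factor 1 as [a ^+ 2 + b ^+ 2] leaves a polynomial identity in the real and imaginary
   parts. *)
move=> ab; rewrite -[RHS]mul1r -ab !sqr_modulus.
by case: z w => [u v] [s t] /=; ring.
Qed.

Lemma A_inner_combl (R : realType) (H : completeNormedModType R[i])
    (dot : {dot H for @Num.conj R[i]}) (A : {linear H -> H}) (a b : R[i])
    (x y z : H) :
  A_inner dot A (a *: x + b *: y) z =
  a * A_inner dot A x z + b * A_inner dot A y z.
Proof. by rewrite /A_inner linearD !linearZ /= linearDl !linearZl_LR. Qed.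

Theorem theorem2p20 (R : realType) (H : completeNormedModType R[i])
    (dot : {dot H for @Num.conj R[i]}) (A B C : {linear H -> H}) :
  induces_norm dot ->
  bounded_operator A -> bounded_operator B -> bounded_operator C ->
  positive_operator dot A -> (exists x : H, A x != 0) ->
  forall alpha : R, 0 <= alpha <= 1 ->
  let a : R[i] := (Num.sqrt alpha)%:C in
  let b : R[i] := (Num.sqrt (1 - alpha))%:C in
  let w (T : {linear H -> H}) := A_numerical_radius dot A T in
  let we := A_euclidean_radius dot A B C in
  [/\ (w (a \*: B \+ b \*: C)%R ^+ 2 <= we ^+ 2)%E,
      (w (a \*: B \- b \*: C)%R ^+ 2 <= we ^+ 2)%E
    & (we ^+ 2 <= w (a \*: B \+ b \*: C)%R ^+ 2 + w (b \*: B \- a \*: C)%R ^+ 2)%E].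
Proof.
move=> _ _ _ _ _ _ alpha /andP[alpha0 alpha1] a b w we.
rewrite /we /w /A_euclidean_radius /A_numerical_radius.
(* With no [A]-unit vector every supremum is [-oo], so all sides equal [+oo]. *)
have [->|X0] := eqVneq [set x | A_norm dot A x = 1]%classic set0.
  by rewrite !image_set0 ereal_sup0 !expe2.
move/set0P: X0 => X0.
have ab : Num.sqrt alpha ^+ 2 + Num.sqrt (1 - alpha) ^+ 2 = 1.
  by rewrite !sqr_sqrtr ?subr_ge0// addrC subrK.
have sqr_sqrt_sum (z t : R[i]) :
    Num.sqrt (modulus z ^+ 2 + modulus t ^+ 2) ^+ 2 =
    modulus z ^+ 2 + modulus t ^+ 2.
  by rewrite sqr_sqrtr// addr_ge0// sqr_ge0.
split.
- apply: sqr_ereal_sup_image_le => // [x|x Xx]; first exact: modulus_ge0.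
  apply: le_trans (sqr_ereal_sup_image_ge _ Xx (sqrtr_ge0 _)).
  rewrite lee_fin sqr_sqrt_sum /= A_inner_combl.
  by rewrite -(sqr_modulus_rotation _ _ ab) lerDl sqr_ge0.
- apply: sqr_ereal_sup_image_le => // [x|x Xx]; first exact: modulus_ge0.
  apply: le_trans (sqr_ereal_sup_image_ge _ Xx (sqrtr_ge0 _)).
  rewrite lee_fin sqr_sqrt_sum /= -scaleNr A_inner_combl mulNr.
  (* Swapping the two coefficients makes the difference the second coordinate of the rotated
     pair. *)
  rewrite addrC in ab.
  by rewrite -(sqr_modulus_rotation _ _ ab) lerDr sqr_ge0.
- apply: sqr_ereal_sup_image_le => // x Xx.
  (* Both rotated coordinates are kept here, and each is bounded by its own supremum. *)
  rewrite sqr_sqrt_sum -(sqr_modulus_rotation _ _ ab) EFinD.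
  rewrite -mulNr -!A_inner_combl scaleNr.
  by apply: leeD; apply: (sqr_ereal_sup_image_ge _ Xx); exact: modulus_ge0.
Qed.
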